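(* Let $t\ge2$, $N=t+2$, and let $\mathcal{T}_t$ be the set of partitions with at most $N$ parts of two-class profile. Let $(d_1,d_2,d_3)$ be an interval triple attained by some element of $\mathcal{T}_t$, and set $k_A=d_1/t-1$, $k_B=d_2/t-1$. The fibre $\{\lambda\in\mathcal{T}_t: (d_1(\lambda),d_2(\lambda),d_3(\lambda))=(d_1,d_2,d_3)\}$ is infinite. It is the disjoint union of branches indexed by the pairs $0\le r_A<r_B\le t-1$ and the signs $\eta=\pm1$ for which $$c:=\tfrac12\Bigl(\tfrac{\eta\,d_3-2(r_A-r_B)}{t}-k_A+k_B\Bigr)\in\mathbb{Z},$$ the two signs giving one and the same branch when $d_3=0$. The branch consists of the $\lambda\in\mathcal{T}_t$ with distinguished residues $r_A,r_B$ and $\lambda^{(r_A)}=(v+k_A,v)$, $\lambda^{(r_B)}=(v-c+k_B,v-c)$, $\lambda^{(i)}=(m_i)$ for $i\neq r_A,r_B$, the free parameters being an integer $v\ge\max(0,c)$ and $(m_i)\in\mathbb{Z}_{\ge0}^{t-2}$. Consequently $$\sum_{\lambda\text{ in the fibre}}q^{|\lambda|}=\frac{\sum_{\text{branches}}q^{\,e}}{(1-q^{4t})(1-q^t)^{t-2}},\qquad e=\kappa(r_A,r_B)+t(k_A+k_B-2c)+4t\max(0,c),$$ and the number of $\lambda$ in the fibre with $|\lambda|\le n$ is, for all sufficiently large $n$, a quasi-polynomial in $n$ of degree $t-1$.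
   Context: For $\lambda=(\lambda_1\ge\dots\ge\lambda_N\ge0)$ let $\beta_j=\lambda_j+N-j$ and $\beta(\lambda)=\{\beta_1>\dots>\beta_N\}$. $\lambda$ has two-class profile if exactly two residue classes modulo $t$, the distinguished residues $r_A<r_B$ in $\{0,\dots,t-1\}$, contain two elements of $\beta(\lambda)$, and every other class exactly one. If $\{a_1>a_2\}$, $\{b_1>b_2\}$ are the elements of $\beta(\lambda)$ in classes $r_A$, $r_B$, the interval triple of $\lambda$ is $d_1=a_1-a_2$, $d_2=b_1-b_2$, $d_3=|a_1+a_2-b_1-b_2|$. The $t$-quotient $(\lambda^{(0)},\dots,\lambda^{(t-1)})$ is computed from this $N$-element beta set: if the elements of $\beta(\lambda)$ congruent to $i$ are $t\tilde a_1+i>\dots>t\tilde a_{n}+i$, then $\lambda^{(i)}=(\tilde a_1-n+1,\dots,\tilde a_n)$. The $t$-core of $\lambda\in\mathcal{T}_t$ depends only on $(r_A,r_B)$ and $\kappa(r_A,r_B)$ denotes its size: it is the partition whose $N$-element beta set is $\{0,1,\dots,t-1\}\cup\{t+r_A,t+r_B\}$. *)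

(* Defs.v *)
From HB Require Import structures.
From mathcomp Require Import all_boot all_order all_algebra finmap.
From mathcomp Require Import boolp classical_sets functions cardinality.

Set Implicit Arguments.
Unset Strict Implicit.
Unset Printing Implicit Defensive.

Import Order.TTheory GRing.Theory Num.Theory.

Local Open Scope classical_set_scope.

(* A partition with at most N parts is a weakly decreasing sequence of length
   exactly N, padded with zeros; its size is [sumn]. *)

(* [j] counts from 0, so that N - j in 1-based notation is [size la - j.+1]. *)
Definition beta (la : seq nat) : seq nat :=
  mkseq (fun j => nth 0 la j + (size la - j.+1)) (size la).

(* Inverse of [beta].  On a strictly decreasing [s] the truncated subtraction
   is exact, since then size s - j.+1 <= nth 0 s j. *)
Definition of_beta (s : seq nat) : seq nat :=
  mkseq (fun j => nth 0 s j - (size s - j.+1)) (size s).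

Lemma beta_of_beta (s : seq nat) : sorted gtn s -> beta (of_beta s) = s.
Proof.
move=> ss; apply: (@eq_from_nth _ 0) => [|j]; first by rewrite !size_mkseq.
rewrite !size_mkseq => js; rewrite !nth_mkseq ?size_mkseq // subnK //.
elim: s ss j js => // x s IH /= ps [_|j js] /=; last first.
  by rewrite subSS; apply: IH => //; exact: path_sorted ps.
rewrite subSS subn0; case: s IH ps => // y s IH /= /andP[yx ps].
by have := IH ps 0 isT; rewrite /= subSS subn0 => /leq_ltn_trans; apply.
Qed.

Definition residue_class (t : nat) (la : seq nat) (r : nat) : seq nat :=
  [seq b <- beta la | b %% t == r].

Definition t_quotient (t : nat) (la : seq nat) (i : nat) : seq nat :=
  of_beta [seq b %/ t | b <- residue_class t la i].

Definition distinguished (t : nat) (la : seq nat) : seq nat :=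
  [seq r <- iota 0 t | size (residue_class t la r) == 2].

Definition two_class_profile (t : nat) (la : seq nat) : bool :=
  (size (distinguished t la) == 2) &&
  all (fun r => (r \in distinguished t la)
                || (size (residue_class t la r) == 1)) (iota 0 t).

Definition two_class (t : nat) : set (t.+2.-tuple nat) :=
  [set la | sorted geq la && two_class_profile t la].
Arguments two_class : clear implicits.

Definition interval_triple (t : nat) (la : seq nat) : nat * nat * nat :=
  let A := residue_class t la (nth 0 (distinguished t la) 0) in
  let B := residue_class t la (nth 0 (distinguished t la) 1) in
  let: (a1, a2) := (nth 0 A 0, nth 0 A 1) in
  let: (b1, b2) := (nth 0 B 0, nth 0 B 1) in
  (a1 - a2, b1 - b2, absz (Posz (a1 + a2) - Posz (b1 + b2))%R).

Definition fibre (t d1 d2 d3 : nat) : set (t.+2.-tuple nat) :=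
  [set la | two_class t la /\ interval_triple t la = (d1, d2, d3)].
Arguments fibre : clear implicits.

Definition core_beta (t rA rB : nat) : seq nat :=
  [:: t + rB, t + rA & rev (iota 0 t)].

Definition kappa (t rA rB : nat) : nat := sumn (of_beta (core_beta t rA rB)).

Lemma core_beta_sorted (t rA rB : nat) :
  rA < rB -> sorted gtn (core_beta t rA rB).
Proof.
move=> rAB; rewrite /core_beta /= ltn_add2l rAB /= path_sortedE; last first.
  by move=> x y z xy yz; apply: ltn_trans yz xy.
apply/andP; split; last by rewrite rev_sorted iota_ltn_sorted.
by apply/allP => i; rewrite mem_rev mem_iota /= add0n => /ltn_addr.
Qed.

Local Open Scope ring_scope.

(* The sign eta is encoded by a boolean: eta = (-1) ^+ s. *)
Definition branch_index (t : nat) : Type := ('I_t * 'I_t * bool)%type.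

Section Branches.
Variables (t d1 d2 d3 : nat).

Definition kA : rat := d1%:R / t%:R - 1.
Definition kB : rat := d2%:R / t%:R - 1.

Definition branch_shift (x : branch_index t) : rat :=
  let: (rA, rB, s) := x in
  (((-1) ^+ s * d3%:R - 2 * (rA%:R - rB%:R)) / t%:R - kA + kB) / 2.

Definition admissible (x : branch_index t) : bool :=
  let: (rA, rB, _) := x in (rA < rB)%N && (branch_shift x \is a Num.int).

(* One index for each branch: when d3 = 0 only the sign +1 is kept. *)
Definition representative (x : branch_index t) : bool :=
  admissible x && ((d3 != 0%N) || ~~ x.2).

(* Only the values m i with i < t and i <> rA, rB are relevant. *)
Definition branch_point (x : branch_index t) (v : int) (m : nat -> nat)
    (la : t.+2.-tuple nat) : Prop :=
  let: (rA, rB, _) := x in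
  [/\ two_class t la,
      distinguished t la = [:: nat_of_ord rA; nat_of_ord rB],
      [seq n%:R : rat | n <- t_quotient t la rA] = [:: v%:~R + kA; v%:~R],
      [seq n%:R : rat | n <- t_quotient t la rB] =
        [:: v%:~R - branch_shift x + kB; v%:~R - branch_shift x] &
      forall i : nat, (i < t)%N -> i <> rA -> i <> rB ->
        t_quotient t la i = [:: m i]].

Definition branch (x : branch_index t) : set (t.+2.-tuple nat) :=
  [set la | exists (v : int) (m : nat -> nat),
     Num.max 0 (branch_shift x) <= v%:~R /\ branch_point x v m la].

Definition expo (x : branch_index t) : rat :=
  let: (rA, rB, _) := x in
  (kappa t rA rB)%:R + t%:R * (kA + kB - 2 * branch_shift x)
  + 4 * t%:R * Num.max 0 (branch_shift x).

(* [expo x] is a natural number for admissible x; [Num.truncn] is the cast. *)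
Definition branch_numerator : {poly int} :=
  \sum_(x : branch_index t | representative x) 'X^(Num.truncn (expo x)).

Definition branch_denominator : {poly int} :=
  (1 - 'X^(4 * t)) * (1 - 'X^t) ^+ (t - 2).

End Branches.

Definition ncard (T : choiceType) (A : set T) : nat := #|` fset_set A|%fset.

Definition count_eq (t d1 d2 d3 n : nat) : nat :=
  ncard (fibre t d1 d2 d3 `&` [set la | sumn la = n]).

Definition count_le (t d1 d2 d3 n : nat) : nat :=
  ncard (fibre t d1 d2 d3 `&` [set la | (sumn la <= n)%N]).

(* [fset_set] is only meaningful on finite sets, and both counts are of this
   kind. *)
Lemma finite_sumn_le (N n : nat) :
  finite_set [set la : N.-tuple nat | (sumn la <= n)%N].
Proof.
pose f (u : N.-tuple 'I_n.+1) : N.-tuple nat := [tuple of map val u].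
apply: (@sub_finite_set _ _ (f @` [set: N.-tuple 'I_n.+1])); last first.
  exact/finite_image/finite_finset.
move=> la /= lan; exists [tuple of map inord la] => //.
apply: val_inj; rewrite /= -map_comp -[RHS]map_id; apply/eq_in_map => i /= ila.
rewrite inordK // ltnS (leq_trans _ lan) //.
elim: (tval la) ila => // a s IH; rewrite inE => /orP[/eqP->|/IH] /=.
  exact: leq_addr.
by move=> /leq_trans; apply; exact: leq_addl.
Qed.

(* The formal power series \sum_n F n q^n is the quotient P / Q, where Q has
   constant term 1 and hence is invertible as a series. *)
Definition series_quotient (F : nat -> int) (P Q : {poly int}) : Prop :=
  Q`_0 = 1 /\ forall n : nat, \sum_(i < n.+1) Q`_i * F (n - i)%N = P`_n.

(* Quasi-polynomials with periodic coefficients a i, the leading one not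
   identically zero. *)
Definition quasi_polynomial (deg : nat) (g : nat -> rat) : Prop :=
  exists (p : nat) (a : nat -> nat -> rat),
    [/\ (0 < p)%N,
        forall i n : nat, a i (n + p)%N = a i n,
        exists n : nat, a deg n <> 0 &
        forall n : nat, g n = \sum_(i < deg.+1) a i n * n%:R ^+ i].

Definition eventually_quasi_polynomial (deg : nat) (f : nat -> nat) : Prop :=
  exists g : nat -> rat, quasi_polynomial deg g /\
    exists n0 : nat, forall n : nat, (n0 <= n)%N -> (f n)%:R = g n.

(* Main.v *)
(* A two-class partition is determined by its t-quotient, and any family of
   partitions with the right lengths is a t-quotient: the residue classes of the
   beta set can be filled independently.  So a point of T_t is the same as
   residues r_A < r_B, quotients (v + k, v), (u + l, u) at these residues and an
   integer m_i at each other residue.  The interval triple fixes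
   k = d_1/t - 1 and l = d_2/t - 1 and, up to the sign eta, the difference
   c = v - u.  The size is kappa + t(2v + k + 2u + l + sum of the m_i), whence
   on each branch the generating function q^e / ((1 - q^(4t)) (1 - q^t)^(t-2)).

   For the quasi-polynomial, let p = 4t.  Multiplying the generating function of
   the counts |lambda| <= n by the denominator gives the partial sums of the
   numerator, which are eventually the number of branches.  Dividing back by one
   factor 1 - q^w with w | p amounts to a discrete integration along every
   progression r + p k; it preserves eventual polynomiality and positivity of
   the leading coefficient, and raises the degree by one. *)
Require Import Defs.
From mathcomp Require Import all_boot all_order all_algebra finmap.
From mathcomp Require Import boolp classical_sets functions cardinality.
From mathcomp Require Import zify ring lra.

Set Implicit Arguments.
Unset Strict Implicit.
Unset Printing Implicit Defensive.

Import Order.TTheory GRing.Theory Num.Theory.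

(** * Beta sets and quotients *)

Lemma of_betaK (q : seq nat) : of_beta (beta q) = q.
Proof.
apply: (@eq_from_nth _ 0) => [|j]; first by rewrite !size_mkseq.
by rewrite !size_mkseq => js; rewrite !nth_mkseq ?size_mkseq // addnK.
Qed.

Lemma size_beta q : size (beta q) = size q.
Proof. by rewrite size_mkseq. Qed.

Lemma size_of_beta s : size (of_beta s) = size s.
Proof. by rewrite size_mkseq. Qed.

(** The shift of an entry is the number of entries after it, so a new head leaves the other shifts
    unchanged. *)
Lemma beta_cons x q : beta (x :: q) = x + size q :: beta q.
Proof.
rewrite /beta /= /mkseq /= subn1 /=; congr (_ :: _).
by rewrite -[1]/(1 + 0) iotaDl -map_comp; apply: eq_map => i /=;
  rewrite add1n /= subSS.
Qed.

Lemma gtn_trans : transitive gtn.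
Proof. by move=> x y z; lia. Qed.

Lemma geq_trans : transitive geq.
Proof. by move=> x y z; lia. Qed.

Lemma beta_sorted q : sorted geq q -> sorted gtn (beta q).
Proof.
elim: q => // x [|y q] IH //; rewrite !beta_cons.
move=> /= /andP[yx sq]; rewrite (_ : _ < _) /=; last by lia.
by have := IH sq; rewrite beta_cons.
Qed.

Lemma of_beta_sorted s : sorted gtn s -> sorted geq (of_beta s).
Proof.
move=> ss; have := beta_of_beta ss; move: (of_beta s) => q def_s.
move: ss; rewrite -{}def_s; elim: q => // x [|y q] IH //.
rewrite !beta_cons => /= /andP[yx sq]; apply/andP; split; first by lia.
by apply: IH; rewrite beta_cons.
Qed.

(** The shifts are 0, ..., N - 1, so sizes of partitions of equal length can be compared through
    their beta sets. *)
Lemma sumn_beta q : sumn (beta q) = sumn q + sumn (iota 0 (size q)).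
Proof.
elim: q => // x q IH; rewrite beta_cons; rewrite [size (_ :: _)]/= -addn1.
by rewrite iotaD sumn_cat /= IH; lia.
Qed.

(** * Residue classes of a beta set and their gluing *)

Section Glue.
Variable t : nat.
Hypothesis t_gt0 : 0 < t.

Lemma residue_class_sorted la r :
  sorted geq la -> sorted gtn (residue_class t la r).
Proof. by move=> /beta_sorted; apply: sorted_filter; exact: gtn_trans. Qed.

Lemma residue_class_divn la r :
  residue_class t la r =
    [seq t * a + r | a <- [seq b %/ t | b <- residue_class t la r]].
Proof.
rewrite -map_comp -[LHS]map_id; apply/eq_in_map => b.
by rewrite mem_filter => /andP[/eqP <- _] /=; rewrite {1}(divn_eq b t) mulnC.
Qed.

Lemma map_affine_sorted r l :
  sorted gtn [seq t * a + r | a <- l] = sorted gtn l.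
Proof.
rewrite sorted_map; apply: eq_sorted => x y /=.
by rewrite ltn_add2r ltn_pmul2l.
Qed.

Lemma residue_class_quotient la r : sorted geq la ->
  residue_class t la r = [seq t * a + r | a <- beta (t_quotient t la r)].
Proof.
move=> sla; rewrite /t_quotient beta_of_beta -?residue_class_divn //.
by rewrite -(map_affine_sorted r) -residue_class_divn residue_class_sorted.
Qed.

Lemma size_t_quotient la r :
  size (t_quotient t la r) = size (residue_class t la r).
Proof. by rewrite size_of_beta size_map. Qed.

Lemma t_quotient_sorted la r : sorted geq la -> sorted geq (t_quotient t la r).
Proof.
move=> sla; apply: of_beta_sorted.
by rewrite -(map_affine_sorted r) -residue_class_divn residue_class_sorted.
Qed.

(** The quotients determine every residue class, hence the elements of the beta set, and these
    determine a strictly decreasing sequence. *)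
Lemma t_quotient_inj la la' : sorted geq la -> sorted geq la' ->
  (forall r, r < t -> t_quotient t la r = t_quotient t la' r) -> la = la'.
Proof.
move=> sla sla' qq; rewrite -(of_betaK la) -(of_betaK la'); congr of_beta.
apply: (irr_sorted_eq gtn_trans); rewrite ?beta_sorted //.
  by move=> x /=; rewrite ltnn.
move=> b; have /qq eqq : b %% t < t by rewrite ltn_mod.
have := residue_class_quotient (b %% t) sla.
rewrite {}eqq -residue_class_quotient // => /(congr1 (fun s => b \in s)).
by rewrite !mem_filter eqxx.
Qed.

Lemma perm_residue_classes s :
  perm_eq (flatten [seq [seq b <- s | b %% t == r] | r <- iota 0 t]) s.
Proof.
apply/permP => a; rewrite count_flatten -map_comp; elim: s => [|b s IH] /=.
  by elim: (iota 0 t) => //= x l ->.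
rewrite -IH.
have /(bigD1_seq (b %% t)) E : b %% t \in iota 0 t.
  by rewrite mem_iota /= ltn_mod.
rewrite !sumnE !big_map !E ?iota_uniq //= eqxx addnA /=; congr (_ + _).
by apply: eq_bigr => r; rewrite eq_sym => /negbTE ->.
Qed.

Lemma sumn_beta_quotient la : sorted geq la ->
  sumn (beta la) =
    sumn [seq sumn [seq t * a + r | a <- beta (t_quotient t la r)]
         | r <- iota 0 t].
Proof.
move=> sla; rewrite -(perm_sumn (perm_residue_classes (beta la))).
rewrite sumn_flatten -map_comp; congr sumn; apply: eq_map => r /=.
by rewrite -residue_class_quotient.
Qed.

(** The class of [r] has to be the image of [beta (q r)] under a -> t a + r. These images are
    disjoint, and sorting their union gives the beta set. *)
Lemma t_quotient_onto (q : nat -> seq nat) n :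
    (forall r, r < t -> sorted geq (q r)) ->
    sumn [seq size (q r) | r <- iota 0 t] = n ->
  exists la : n.-tuple nat,
    sorted geq la /\ forall r, r < t -> t_quotient t la r = q r.
Proof.
move=> sq szq.
pose cls r := [seq t * a + r | a <- beta (q r)].
have mod_cls r b : r < t -> b \in cls r -> b %% t = r.
  by move=> rt /mapP[a _ ->]; rewrite mulnC modnMDl modn_small.
have cls_sorted r : r < t -> sorted gtn (cls r).
  by move=> /sq/beta_sorted; rewrite map_affine_sorted.
pose s := sort geq (flatten [seq cls r | r <- iota 0 t]).
have mem_s b : (b \in s) = (b \in cls (b %% t)).
  rewrite mem_sort; apply/flatten_mapP/idP => [[r]|bc].
    by rewrite mem_iota => rt /[dup]/(mod_cls _ _ rt) ->.
  by exists (b %% t) => //; rewrite mem_iota ltn_mod.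
have uniq_cls r : r < t -> uniq (cls r).
  move=> /cls_sorted/sorted_uniq; apply; first exact: gtn_trans.
  by move=> x /=; rewrite ltnn.
have us : uniq s.
  rewrite sort_uniq; have : all (gtn t) (iota 0 t).
    by apply/allP => x; rewrite mem_iota.
  (* The residue of an element recovers the index of its class, so distinct classes share no
     element. *)
  elim: (iota 0 t) (iota_uniq 0 t) => //= r l IH /andP[rl ul] /andP[rt lt].
  rewrite cat_uniq uniq_cls //= IH // andbT.
  apply/hasPn => b /flatten_mapP[r' r'l br'].
  apply: contra rl => br; rewrite -(mod_cls r b) //.
  by rewrite (mod_cls r' b) //; exact: (allP lt).
(* Sorting yields weak decrease only; the absence of repetitions makes it strict. *)
have ss : sorted gtn s.
  have : sorted geq s by apply: sort_sorted => x y /=; lia.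
  elim: (s) us => // x l IH /= /andP[xl ul]; rewrite path_sortedE;
    last exact: geq_trans.
  rewrite path_sortedE; last exact: gtn_trans.
  move=> /andP[/allP xall sl]; rewrite IH // andbT; apply/allP => y yl /=.
  rewrite ltn_neqAle [_ <= _]xall // andbT; apply: contraNneq xl => <-;
    exact: yl.
have szs : size (of_beta s) == n.
  rewrite size_of_beta size_sort size_flatten /shape -map_comp -szq.
  by apply/eqP; congr sumn; apply: eq_map => r /=; rewrite size_map size_beta.
exists (Tuple szs); split => [|r rt]; first exact: of_beta_sorted.
rewrite /t_quotient /residue_class /= beta_of_beta //.
suff -> : [seq b <- s | b %% t == r] = cls r.
  rewrite -map_comp (_ : map _ _ = beta (q r)) ?of_betaK //.
  rewrite -[RHS]map_id; apply: eq_map => a /=.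
  by rewrite mulnC divnMDl // divn_small // addn0.
apply: (irr_sorted_eq gtn_trans) => [x /=||| b].
- by rewrite ltnn.
- by apply: sorted_filter ss; exact: gtn_trans.
- exact: cls_sorted.
rewrite mem_filter mem_s; case: eqP => [<- //|] /= br.
by apply/esym/negP => /(mod_cls _ _ rt).
Qed.

End Glue.

(** * Partitions of two-class profile *)

(** Storing the smaller part and the difference makes each pair weakly decreasing by construction;
    [u] stands for v - c, [k] and [l] for k_A and k_B. *)
Definition two_class_quotient (rA rB v k u l : nat) (m : nat -> nat)
    (r : nat) : seq nat :=
  if r == rA then [:: v + k; v]
  else if r == rB then [:: u + l; u]
  else [:: m r].

Definition other_residues (t rA rB : nat) : seq nat :=
  [seq r <- iota 0 t | (r != rA) && (r != rB)].

Section TwoClass.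
Variables (t rA rB : nat).
Hypotheses (rAB : rA < rB) (rBt : rB < t).

Let t_gt0 : 0 < t. Proof. by lia. Qed.

Lemma perm_other_residues :
  perm_eq (iota 0 t) [:: rA, rB & other_residues t rA rB].
Proof.
apply: uniq_perm; rewrite ?iota_uniq //= ?inE ?mem_filter.
  by rewrite !eqxx andbF filter_uniq ?iota_uniq //= orbF; lia.
by move=> r; rewrite !inE mem_filter mem_iota; lia.
Qed.

Lemma sum_residues (F : nat -> nat) :
  sumn [seq F r | r <- iota 0 t] =
    F rA + F rB + sumn [seq F r | r <- other_residues t rA rB].
Proof. by rewrite (perm_sumn (perm_map F perm_other_residues)) /= addnA. Qed.

Lemma size_other_residues : size (other_residues t rA rB) = t - 2.
Proof. by have /= := perm_size perm_other_residues; rewrite size_iota; lia. Qed.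

Section Data.
Variables (v k u l : nat) (m : nat -> nat).
Let Q := two_class_quotient rA rB v k u l m.

Let QA : Q rA = [:: v + k; v].
Proof. by rewrite /Q /two_class_quotient eqxx. Qed.
Let QB : Q rB = [:: u + l; u].
Proof. by rewrite /Q /two_class_quotient eqxx gtn_eqF. Qed.

Lemma sum_other_quotients (F : seq nat -> nat) :
  sumn [seq F (Q r) | r <- other_residues t rA rB] =
    sumn [seq F [:: m r] | r <- other_residues t rA rB].
Proof.
congr sumn; apply/eq_in_map => r; rewrite mem_filter => /andP[/andP[]].
by rewrite /Q /two_class_quotient => /negbTE -> /negbTE ->.
Qed.

Lemma two_class_quotient_onto : exists la : t.+2.-tuple nat,
  sorted geq la /\ forall r, r < t -> t_quotient t la r = Q r.
Proof.
apply: t_quotient_onto => // [r rt|].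
  by rewrite /Q /two_class_quotient; do ![case: ifP => _ //=]; lia.
rewrite (sum_residues (fun r => size (Q r))) QA QB.
rewrite (sum_other_quotients size) /=.
by rewrite sumnE big_map sum1_size size_other_residues; lia.
Qed.

Variable la : seq nat.
Hypotheses (sla : sorted geq la)
  (qla : forall r, r < t -> t_quotient t la r = Q r).

Lemma distinguished_two_class : distinguished t la = [:: rA; rB].
Proof.
apply: (irr_sorted_eq ltn_trans ltnn); rewrite /= ?rAB //.
  exact/(sorted_filter ltn_trans)/iota_ltn_sorted.
move=> r; rewrite mem_filter mem_iota !inE /= add0n -size_t_quotient.
case: (ltnP r t) => rt /=; last by rewrite andbF; lia.
rewrite andbT (qla rt) /Q /two_class_quotient.
by case: (r == rA) => //; case: (r == rB).
Qed.

Lemma two_class_profileT : two_class_profile t la.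
Proof.
rewrite /two_class_profile distinguished_two_class /=.
apply/allP => r; rewrite mem_iota => /= rt.
rewrite !inE -size_t_quotient qla // /Q /two_class_quotient.
by case: (r == rA) => //; case: (r == rB).
Qed.

(** The class of [rA] is {t (v + k + 1) + rA, t v + rA}, likewise for [rB]; in the difference of the
    two sums the extra [t] cancels. *)
Lemma interval_triple_two_class : interval_triple t la =
  (t * k.+1, t * l.+1,
   absz ((t * (2 * v + k) + 2 * rA)%:Z - (t * (2 * u + l) + 2 * rB)%:Z)%R).
Proof.
have rAt := ltn_trans rAB rBt.
rewrite /interval_triple distinguished_two_class /=.
rewrite !residue_class_quotient // !qla // QA QB !beta_cons /=.
by congr (_, _, _); nia.
Qed.

(** Both [la] and the core have beta sets with t + 2 elements, so the triangular terms agree and the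
    sizes differ as the sums of the beta sets do. *)
Lemma sumn_two_class : size la = t.+2 ->
  sumn la = kappa t rA rB +
    t * (2 * v + k + (2 * u + l) +
         sumn [seq m r | r <- other_residues t rA rB]).
Proof.
move=> szla; have Ela := sumn_beta la;
  have Ek := sumn_beta (of_beta (core_beta t rA rB)).
move: Ek; rewrite beta_of_beta ?core_beta_sorted // -/(kappa _ _ _)
  size_of_beta.
have -> : size (core_beta t rA rB) = size la.
  by rewrite /= size_rev size_iota szla.
move: Ela; rewrite (sumn_beta_quotient t_gt0 sla);
  set tri := sumn (iota 0 (size la)).
have -> : [seq sumn [seq t * a + r | a <- beta (t_quotient t la r)]
            | r <- iota 0 t]
  = [seq sumn [seq t * a + r | a <- beta (Q r)] | r <- iota 0 t].
  by apply/eq_in_map => r; rewrite mem_iota => /= rt; rewrite qla.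
rewrite (sum_residues (fun r => sumn [seq t * a + r | a <- beta (Q r)])).
rewrite QA QB !beta_cons /=.
have -> : sumn [seq sumn [seq t * a + r | a <- beta (Q r)]
                | r <- other_residues t rA rB] =
   t * sumn [seq m r | r <- other_residues t rA rB]
   + sumn (other_residues t rA rB).
  rewrite !sumnE !big_map big_distrr /= -big_split /= !big_seq.
  apply: eq_bigr => r; rewrite mem_filter => /andP[/andP[rA' rB'] _].
  by rewrite /Q /two_class_quotient (negbTE rA') (negbTE rB') /= !addn0.
rewrite sumn_rev (perm_sumn perm_other_residues) /=; nia.
Qed.

End Data.

Lemma two_class_quotient_inj v k u l m v' u' m' (la : seq nat) :
    (forall r, r < t ->
       t_quotient t la r = two_class_quotient rA rB v k u l m r) ->
    (forall r, r < t ->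
       t_quotient t la r = two_class_quotient rA rB v' k u' l m' r) ->
  [/\ v = v', u = u' & {in other_residues t rA rB, m =1 m'}].
Proof.
move=> q q'; have qq r rt := etrans (esym (q r rt)) (q' r rt).
move: {q q'}qq; rewrite /two_class_quotient => qq; split.
- by have := qq _ (ltn_trans rAB rBt); rewrite eqxx => -[].
- by have := qq _ rBt; rewrite eqxx gtn_eqF // => -[].
move=> r; rewrite mem_filter mem_iota =>
  /andP[/andP[/negbTE rA' /negbTE rB'] /=].
by move=> /qq; rewrite rA' rB' => -[].
Qed.

End TwoClass.

Lemma two_class_quotientP t (la : t.+2.-tuple nat) : 0 < t -> two_class t la ->
  exists rA rB v k u l m,
    [/\ rA < rB, rB < t, sorted geq la &
        forall r, r < t ->
          t_quotient t la r = two_class_quotient rA rB v k u l m r].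
Proof.
move=> t_gt0 /andP[sla] /andP[].
have : sorted ltn (distinguished t la).
  exact/(sorted_filter ltn_trans)/iota_ltn_sorted.
case E : (distinguished t la) => [|rA [|rB []]] //= /andP[rAB _] _.
have dP r : (r \in [:: rA; rB]) = (r < t) && (size (t_quotient t la r) == 2).
  by rewrite -E mem_filter mem_iota size_t_quotient andbC.
have dP2 r : r \in [:: rA; rB] ->
    r < t /\ exists v k, t_quotient t la r = [:: v + k; v].
  rewrite dP => /andP[rt]; have := t_quotient_sorted t_gt0 r sla.
  case: (t_quotient t la r) => [|x [|y []]] //= /andP[yx _] _; split => //.
  by exists y, (x - y); rewrite subnKC.
have [rAt [v [k qA]]] := dP2 rA ltac:(by rewrite !inE eqxx).
have [rBt [u [l qB]]] := dP2 rB ltac:(by rewrite !inE eqxx orbT).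
move=> /allP qo.
exists rA, rB, v, k, u, l, (fun r => head 0 (t_quotient t la r)).
split => // r rt; rewrite /two_class_quotient.
case: eqP => [->//|/eqP rA']; case: eqP => [->//|/eqP rB'].
have := qo r; rewrite mem_iota => /(_ rt).
rewrite !inE (negbTE rA') (negbTE rB') /= -size_t_quotient.
by case: (t_quotient t la r) => [|x []].
Qed.

(** * Solutions of a linear equation with positive weights *)

Fixpoint weight (ws p : seq nat) : nat :=
  match ws, p with
  | w :: ws', a :: p' => a * w + weight ws' p'
  | _, _ => 0
  end.

(** For positive weights the length of this list is the coefficient of q^n in the product of the
    series 1 / (1 - q^w). *)
Fixpoint solutions (ws : seq nat) (n : nat) : seq (seq nat) :=
  if ws is w :: ws' then
    [seq a :: p | a <- [seq a <- iota 0 n.+1 | a * w <= n],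
                  p <- solutions ws' (n - a * w)]
  else if n == 0 then [:: [::]] else [::].

Lemma solutions_cons w ws n : solutions (w :: ws) n =
  [seq a :: p | a <- [seq a <- iota 0 n.+1 | a * w <= n],
                p <- solutions ws (n - a * w)].
Proof. by []. Qed.

(** A positive weight forces a <= n, so the cut-off in [iota 0 n.+1] loses no solution. *)
Lemma mem_solutions ws n p : all (leq 1) ws ->
  (p \in solutions ws n) = (size p == size ws) && (weight ws p == n).
Proof.
elim: ws n p => [|w ws IH] n p; first by case: n p => [|n] [].
rewrite solutions_cons [all _ _]/= => /andP[w0 /IH{}IH]; apply/allpairsPdep/idP.
  move=> [a [q [ah]]]; rewrite IH => /andP[szq /eqP wq] -> /=.
  by rewrite eqSS szq /= wq; move: ah; rewrite mem_filter; lia.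
case: p => // a q /andP[szq /eqP <-]; exists a, q; split => //.
  by rewrite mem_filter mem_iota /=; nia.
by rewrite IH /= addKn eqxx andbT.
Qed.

Lemma solutions_uniq ws n : uniq (solutions ws n).
Proof.
elim: ws n => [|w ws IH] n; first by case: n.
rewrite solutions_cons; apply: allpairs_uniq_dep => //;
  first by rewrite filter_uniq // iota_uniq.
by move=> [a p] [b q] _ _ [<- <-].
Qed.

(* Recursion on whether the first unknown is zero: this is multiplication of the
   generating function by 1 - q^w. *)
Lemma size_solutions_cons w ws n : 0 < w ->
  size (solutions (w :: ws) n) = size (solutions ws n) +
    (if w <= n then size (solutions (w :: ws) (n - w)) else 0).
Proof.
move=> w0.
(* The bound [B] on the first unknown is kept apart from [n], so that the sums for [n] and [n - w]
   can be taken over matching ranges. *)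
pose S B n := \sum_(a < B | a * w <= n) size (solutions ws (n - a * w)).
have SE m : size (solutions (w :: ws) m) = S m.+1 m.
  by rewrite solutions_cons size_allpairs_dep sumnE big_map big_filter
    -[iota 0 m.+1]/(index_iota 0 m.+1) big_mkord.
have SB m B : m < B -> S m.+1 m = S B m.
  move=> mB; rewrite /S (big_ord_widen_cond _ (fun a => a * w <= m)
    (fun a => size (solutions ws (m - a * w))) mB).
  by apply: eq_bigl => a; nia.
rewrite (SE n) /S big_mkcond big_ord_recl /= subn0; congr (_ + _).
case: ifP => wn.
  rewrite SE (SB _ n); last by lia.
  rewrite /S [RHS]big_mkcond; apply: eq_bigr => a _ /=.
  rewrite /bump /= add1n mulSn subnDA; congr (if _ then _ else _); lia.
by rewrite big1 // => a _; rewrite ifF // /bump /=; nia.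
Qed.

Local Open Scope classical_set_scope.
Local Open Scope ring_scope.

(** * Branches *)

Section BranchPoints.
Variables (t k l d3 : nat).
Hypothesis t_gt0 : (0 < t)%N.

(** Attained values of d_1 and d_2 are positive multiples of t, so k_A and k_B are the naturals [k]
    and [l]. *)
Let d1 := (t * k.+1)%N.
Let d2 := (t * l.+1)%N.
Let shift (x : branch_index t) := branch_shift d1 d2 d3 x.

Let t_neq0 : t%:R != 0 :> rat. Proof. by rewrite pnatr_eq0 -lt0n. Qed.

Lemma kAE : kA t d1 = k%:R.
Proof. by rewrite /kA natrM mulrC mulKf // -addn1 natrD addrK. Qed.

Lemma kBE : kB t d2 = l%:R.
Proof. by rewrite /kB natrM mulrC mulKf // -addn1 natrD addrK. Qed.

(** The left side of the integer equation is the signed difference of the two class sums; the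
    formula for c solves this equation for v - u. *)
Lemma branch_shiftE (rA rB : 'I_t) s (v u : nat) :
  (shift (rA, rB, s) = v%:R - u%:R) <->
  ((t * (2 * v + k) + 2 * rA)%N%:Z - (t * (2 * u + l) + 2 * rB)%N%:Z
     = (-1) ^+ s * d3%:Z).
Proof.
have -> : (t * (2 * v + k) + 2 * rA)%N%:Z - (t * (2 * u + l) + 2 * rB)%N%:Z
     = (-1) ^+ s * d3%:Z <->
   t%:R * (2 * v%:R + k%:R) + 2 * rA%:R - (t%:R * (2 * u%:R + l%:R) + 2 * rB%:R)
     = (-1) ^+ s * d3%:R :> rat.
  split=> [/(congr1 (fun z : int => z%:~R : rat))|H];
    last apply: (@intr_inj rat).
    rewrite !rmorphB rmorphM rmorphXn rmorphN1 /= => <-.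
    by rewrite -!pmulrn !(natrD, natrM).
  rewrite !rmorphB rmorphM rmorphXn rmorphN1 /= -H.
  by rewrite -!pmulrn !(natrD, natrM).
rewrite /shift /branch_shift kAE kBE; move: (_ ^+ s * _) => e.
split=> [H|<-]; last by field.
have -> : e = t%:R * (2 * (((e - 2 * (rA%:R - rB%:R)) / t%:R - k%:R + l%:R) / 2)
  + k%:R - l%:R) + 2 * (rA%:R - rB%:R) by field.
by rewrite H; ring.
Qed.

Lemma branch_point_quotient (rA rB : 'I_t) s (v u : nat) m la :
    (rA < rB)%N -> shift (rA, rB, s) = v%:R - u%:R ->
  branch_point d1 d2 d3 (rA, rB, s) v%:Z m la <->
  sorted geq la /\
  forall r, (r < t)%N ->
    t_quotient t la r = two_class_quotient rA rB v k u l m r.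
Proof.
move=> rAB; rewrite /branch_point -/(shift _) kAE kBE => ->.
have -> : v%:R - (v%:R - u%:R) = u%:R :> rat by ring.
have natr_inj : injective (fun n : nat => n%:R : rat).
  by move=> i j /eqP; rewrite eqr_nat => /eqP.
split=> [[/andP[sla _] _ qA qB qo]|[sla qla]].
  split=> // r rt; rewrite /two_class_quotient.
  case: eqP => [->|rA']; first by apply: (inj_map natr_inj);
    rewrite /= qA natrD.
  case: eqP => [->|rB']; first by apply: (inj_map natr_inj);
    rewrite /= qB natrD; congr [:: _; _]; ring.
  exact: qo.
split.
- by apply/andP; split=> //;
  exact: (two_class_profileT rAB (ltn_ord rB) sla qla).
- exact: (distinguished_two_class rAB (ltn_ord rB) sla qla).
- by rewrite qla // /two_class_quotient eqxx /= natrD.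
- rewrite qla // /two_class_quotient gtn_eqF // eqxx /= natrD.
  by congr [:: _; _]; ring.
- by move=> r rt /eqP/negbTE rA' /eqP/negbTE rB';
  rewrite qla // /two_class_quotient rA' rB'.
Qed.

(** The bound v >= max(0, c) says that v and u = v - c are naturals, and conversely c = v - u is an
    integer; with [v] and [u] natural the side conditions disappear. *)
Lemma branchP (rA rB : 'I_t) s la : (rA < rB)%N ->
  branch d1 d2 d3 (rA, rB, s) la /\ admissible d1 d2 d3 (rA, rB, s) <->
  exists v u m, [/\ shift (rA, rB, s) = v%:R - u%:R, sorted geq la &
    forall r, (r < t)%N ->
      t_quotient t la r = two_class_quotient rA rB v k u l m r].
Proof.
move=> rAB; split.
  move=> [[v [m []]]]; rewrite ge_max -/(shift _) => /andP[v0 cv] pt.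
  move=> /andP[_ /intrP[c Ec]]; rewrite -/(shift _) in Ec.
  rewrite Ec ler_int in cv; rewrite ler0z in v0.
  have Evu : shift (rA, rB, s) = `|v|%N%:R - `|v - c|%N%:R.
    by rewrite Ec !pmulrn -intrB; congr _%:~R; lia.
  move: pt; rewrite -(gez0_abs v0) =>
    /(branch_point_quotient _ _ rAB Evu)[sla qla].
  by exists `|v|%N, `|v - c|%N, m; split.
move=> [v [u [m [Evu sla qla]]]]; split.
  exists v%:Z, m; split; last exact/(branch_point_quotient _ _ rAB Evu).
  rewrite -/(shift _) Evu ge_max -!pmulrn ler0n /= lerBlDr lerDl ler0n //.
by rewrite /admissible rAB -/(shift _) Evu rpredB ?natr_int.
Qed.

End BranchPoints.

(** * The fibre as a disjoint union of branches *)

Section Fibre.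
Variables (t k l d3 : nat).
Hypothesis t_gt1 : (1 < t)%N.

Let t_gt0 : (0 < t)%N := ltnW t_gt1.
Let d1 := (t * k.+1)%N.
Let d2 := (t * l.+1)%N.
Let shift (x : branch_index t) := branch_shift d1 d2 d3 x.

Lemma fibre_branches :
  fibre t d1 d2 d3 =
    \bigcup_(x in [set x | admissible d1 d2 d3 x]) branch d1 d2 d3 x.
Proof.
apply/seteqP; split=> la.
  move=> [cla]; have [rA [rB [v [k' [u [l' [m [rAB rBt sla qla]]]]]]]] :=
    two_class_quotientP t_gt0 cla.
  rewrite (interval_triple_two_class rAB rBt sla qla).
  move=> [/eqP]; rewrite eqn_pmul2l // => /eqP[ek] /eqP.
  rewrite eqn_pmul2l // => /eqP[el]; subst k' l'.
  set z : int := (_ - _) => absz.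
  (* The sign eta is that of the difference of the class sums, taken as +1 when the difference is
     0. *)
  pose x : branch_index t := (Ordinal (ltn_trans rAB rBt), Ordinal rBt, z < 0).
  have [] : branch d1 d2 d3 x la /\ admissible d1 d2 d3 x; last by exists x.
  apply/branchP => //; exists v, u, m; split => //; apply/branch_shiftE => //=.
  by rewrite -/z -absz; exact: intEsign.
move=> [[[rA rB] s]] /[dup] ax /andP[rAB _] bx.
have [v [u [m [Evu sla qla]]]] := (branchP k l d3 t_gt0 _ _ rAB).1 (conj bx ax).
split; first by apply/andP; split=> //;
  exact: (two_class_profileT rAB _ sla qla).
rewrite (interval_triple_two_class rAB _ sla qla) //.
have /branch_shiftE -> // := Evu.
by rewrite abszMsign.
Qed.

Lemma branch_sign0 (rA rB : 'I_t) : d3 = 0%N ->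
  admissible d1 d2 d3 (rA, rB, false) = admissible d1 d2 d3 (rA, rB, true)
  /\ branch d1 d2 d3 (rA, rB, false) = branch d1 d2 d3 (rA, rB, true).
Proof.
by rewrite /branch /branch_point /admissible /branch_shift => ->;
  rewrite !mulr0.
Qed.

(** A common point fixes [rA], [rB], [v] and [u], hence eta d_3. Either d_3 is nonzero and the signs
    agree, or both signs are +1. *)
Lemma branch_trivIset :
  trivIset [set x | representative d1 d2 d3 x] (@branch t d1 d2 d3).
Proof.
move=> [[rA rB] s] [[rA' rB'] s'] /andP[ax /= rx] /andP[ax' /= rx'].
move=> [la [bx bx']].
have /andP[rAB _] := ax; have /andP[rAB' _] := ax'.
have [v [u [m [Evu sla qla]]]] := (branchP k l d3 t_gt0 _ _ rAB).1 (conj bx ax).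
have [v' [u' [m' [Evu' _ qla']]]] :=
  (branchP k l d3 t_gt0 _ _ rAB').1 (conj bx' ax').
have := distinguished_two_class rAB (ltn_ord rB) sla qla.
rewrite (distinguished_two_class rAB' (ltn_ord rB') sla qla') =>
  -[/val_inj eA /val_inj eB].
subst rA' rB'.
have [ev eu _] := two_class_quotient_inj rAB (ltn_ord rB) qla qla'; subst v' u'.
move: ((branch_shiftE k l d3 t_gt0 _ _ _ _ _).1 Evu').
rewrite ((branch_shiftE k l d3 t_gt0 _ _ _ _ _).1 Evu).
by move: rx rx'; case: s s' {ax ax' bx bx' Evu Evu'} => -[] //=; lia.
Qed.

Lemma branch_point_unique x v m : admissible d1 d2 d3 x ->
    Num.max 0 (branch_shift d1 d2 d3 x) <= v%:~R ->
  exists! la : t.+2.-tuple nat, branch_point d1 d2 d3 x v m la.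
Proof.
case: x => [[rA rB] s] /andP[rAB /intrP[c Ec]].
rewrite Ec ge_max ler0z ler_int => /andP[v0 cv].
have Evu : shift (rA, rB, s) = `|v|%N%:R - `|v - c|%N%:R.
  by rewrite /shift Ec !pmulrn -intrB; congr _%:~R; lia.
have [la [sla qla]] :=
  two_class_quotient_onto rAB (ltn_ord rB) `|v| k `|v - c| l m.
exists la; split; first by rewrite -(gez0_abs v0);
  exact/(branch_point_quotient t_gt0 _ _ rAB Evu).
move=> la'; rewrite -(gez0_abs v0) =>
  /(branch_point_quotient t_gt0 _ _ rAB Evu)[sla' qla'].
by apply/val_inj/(t_quotient_inj t_gt0) => // r rt; rewrite qla // qla'.
Qed.

(* The least v and v - c on the branch; all others are obtained by adding the
   same integer to both. *)
Definition base_A x := Num.truncn (Num.max 0 (shift x)).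
Definition base_B x := Num.truncn (Num.max 0 (- shift x)).

(** [base_A] and [base_B] are the positive and negative parts of c, so one of them vanishes. *)
Lemma baseP x : admissible d1 d2 d3 x ->
  [/\ shift x = (base_A x)%:R - (base_B x)%:R,
      Num.max 0 (shift x) = (base_A x)%:R & minn (base_A x) (base_B x) = 0%N].
Proof.
case: x => [[rA rB] s] /andP[rAB /intrP[c]]; rewrite -/(shift _).
set x := (rA, rB, s) => Ec.
rewrite /base_A /base_B Ec.
have [c0|c0] := leP 0 c.
  rewrite max_r ?ler0z // max_l ?oppr_le0 ?ler0z // -(gez0_abs c0) -pmulrn.
  by rewrite truncn0 natrK subr0 minn0.
rewrite max_l ?lerz0 ?(ltW c0) // max_r ?oppr_ge0 ?lerz0 ?(ltW c0) //.
rewrite -(opprK c) -(ltz0_abs c0) rmorphN /= -pmulrn opprK truncn0 natrK sub0r.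
by rewrite min0n.
Qed.

Definition min_size (x : branch_index t) : nat :=
  (kappa t x.1.1 x.1.2 + t * (2 * base_A x + k + (2 * base_B x + l)))%N.

(** Since [base_B] is [base_A] minus c, twice their sum is 4 max(0, c) - 2c. *)
Lemma expoE x : admissible d1 d2 d3 x -> expo d1 d2 d3 x = (min_size x)%:R.
Proof.
case: x => [[rA rB] s] ax; have [Es Em _] := baseP ax.
rewrite /shift in Es Em.
rewrite /expo Em Es kAE // kBE // /min_size [X in kappa _ X]/=.
by rewrite !(natrD, natrM); ring.
Qed.

(* The head of [p] is v minus its least value, the tail lists the m_i in
   increasing order of the residue i. *)
Definition branch_member (x : branch_index t) (p : seq nat) : t.+2.-tuple nat :=
  let: (rA, rB, _) := x in
  xget (nseq_tuple _ 0%N) [set la : t.+2.-tuple nat | sorted geq la /\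
    forall r, (r < t)%N -> t_quotient t la r =
      two_class_quotient rA rB
        (base_A x + head 0%N p) k (base_B x + head 0%N p) l
        (fun r => nth 0%N (behead p) (index r (other_residues t rA rB))) r].

Lemma branch_memberP (rA rB : 'I_t) s p (x := (rA, rB, s)) : (rA < rB)%N ->
  sorted geq (branch_member x p) /\
  forall r, (r < t)%N -> t_quotient t (branch_member x p) r =
      two_class_quotient rA rB
        (base_A x + head 0%N p) k (base_B x + head 0%N p) l
        (fun r => nth 0%N (behead p) (index r (other_residues t rA rB))) r.
Proof.
(* The default of [xget] is never taken, because every family of quotients of these lengths is
   attained. *)
move=> rAB; rewrite /branch_member /=; case: xgetP => [la _ //|nola].
have [la hla] := two_class_quotient_onto rAB (ltn_ord rB)
  (base_A x + head 0%N p) k (base_B x + head 0%N p) l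
  (fun r => nth 0%N (behead p) (index r (other_residues t rA rB))).
by case: (nola la).
Qed.

Lemma branch_member_in x p :
  admissible d1 d2 d3 x -> branch d1 d2 d3 x (branch_member x p).
Proof.
case: x => [[rA rB] s] /[dup] ax /andP[rAB _].
have [sla qla] := branch_memberP s p rAB.
suff [] : branch d1 d2 d3 (rA, rB, s) (branch_member (rA, rB, s) p)
  /\ admissible d1 d2 d3 (rA, rB, s) by [].
apply/branchP => //.
eexists; eexists; eexists; split; [|exact: sla|exact: qla].
have [Es _ _] := baseP ax; rewrite -/(shift _) Es !natrD.
by ring.
Qed.

Lemma sumn_branch_member x p : admissible d1 d2 d3 x -> size p = t.-1 ->
  sumn (branch_member x p) =
    (min_size x + (4 * t * head 0 p + t * sumn (behead p)))%N.
Proof.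
case: x => [[rA rB] s] /[dup] ax /andP[rAB _] szp.
have [sla qla] := branch_memberP s p rAB.
rewrite (sumn_two_class rAB _ sla qla) ?size_tuple // /min_size /=.
set m := [seq _ | r <- _].
have -> : m = behead p; last by lia.
apply: (@eq_from_nth _ 0%N) => [|i].
  by rewrite size_map size_other_residues // size_behead szp; lia.
rewrite size_map => ilt; rewrite (nth_map 0%N) //.
by rewrite index_uniq // filter_uniq ?iota_uniq.
Qed.

Lemma branch_member_inj x p p' :
  admissible d1 d2 d3 x -> size p = t.-1 -> size p' = t.-1 ->
  branch_member x p = branch_member x p' -> p = p'.
Proof.
case: x => [[rA rB] s] /[dup] ax /andP[rAB _] szp szp' pp.
have [sla qla] := branch_memberP s p rAB; have [_] := branch_memberP s p' rAB.
rewrite -pp => qla'.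
have [/addnI eh _ em] := two_class_quotient_inj rAB (ltn_ord rB) qla qla'.
have [p0 p0'] : (0 < size p)%N /\ (0 < size p')%N by lia.
case: p p' => [|a p] [|a' p'] // in p0 p0' szp szp' eh em {pp sla qla qla'} *.
rewrite /= in szp szp' eh em; congr (_ :: _) => //.
have szo := size_other_residues rAB (ltn_ord rB).
apply: (@eq_from_nth _ 0%N) => [|i ip]; first by lia.
have io : (i < size (other_residues t rA rB))%N by lia.
have := em _ (mem_nth 0%N io).
by rewrite index_uniq // filter_uniq ?iota_uniq.
Qed.

Lemma branch_member_onto x la : admissible d1 d2 d3 x -> branch d1 d2 d3 x la ->
  exists p, size p = t.-1 /\ la = branch_member x p.
Proof.
case: x => [[rA rB] s] /[dup] ax /andP[rAB _] bla.
have [v [u [m [Evu sla qla]]]] :=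
  (branchP k l d3 t_gt0 _ _ rAB).1 (conj bla ax).
have [Es _ base0] := baseP ax; set x := (rA, rB, s) in Es base0.
have szo := size_other_residues rAB (ltn_ord rB).
exists ((v - base_A x)%N :: [seq m r | r <- other_residues t rA rB]).
split; first by rewrite /= size_map szo; lia.
set p := _ :: _; have [slp qlp] := branch_memberP s p rAB.
apply/val_inj/(t_quotient_inj t_gt0) => // r rt; rewrite qla // qlp //.
(* Both pairs have difference c and one of [base_A], [base_B] is 0, so v >= [base_A], and [v] and
   [u] exceed their bases by the same amount. *)
have [Ev Eu] : v = (base_A x + head 0 p)%N /\ u = (base_B x + head 0 p)%N.
  have : (v + base_B x)%N = (base_A x + u)%N.
    apply/eqP; rewrite -(eqr_nat rat) !natrD; apply/eqP.
    by rewrite -/(shift _) in Evu; lra.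
  by rewrite /=; lia.
rewrite /two_class_quotient -Ev -Eu; case: eqP => // /eqP rA';
  case: eqP => // /eqP rB'.
have ro : r \in other_residues t rA rB by rewrite mem_filter rA' rB' mem_iota.
by rewrite (nth_map 0%N) ?index_mem // nth_index.
Qed.

Lemma fibre_members la : fibre t d1 d2 d3 la <->
  exists x p, [/\ representative d1 d2 d3 x,
    size p = t.-1 & la = branch_member x p].
Proof.
rewrite fibre_branches; split=> [[x ax bx]|[x [p [/andP[ax _] _ ->]]]];
  last first.
  by exists x => //; exact: branch_member_in.
(* An admissible index that is not representative has d_3 = 0 and sign -1; switching to sign +1
   keeps the branch. *)
have [y ry by_] : exists2 y, representative d1 d2 d3 y & branch d1 d2 d3 y la.
  have [rx|] := boolP (representative d1 d2 d3 x); first by exists x.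
  rewrite /representative [admissible _ _ _ _]ax /= negb_or !negbK =>
    /andP[/eqP d30].
  case: x => [[rA rB] s] /= in ax bx * => es; rewrite es in ax bx.
  have [ea eb] := branch_sign0 rA rB d30.
  by exists (rA, rB, false); rewrite ?eb // /representative ea orbT andbT.
have /andP[ay _] := ry; have [p [szp ->]] := branch_member_onto ay by_.
by exists y, p.
Qed.

Lemma branch_member_representative_inj x x' p p' :
    representative d1 d2 d3 x -> representative d1 d2 d3 x' ->
    size p = t.-1 -> size p' = t.-1 ->
  branch_member x p = branch_member x' p' -> x = x' /\ p = p'.
Proof.
move=> rx rx' szp szp' pp; have /andP[ax _] := rx; have /andP[ax' _] := rx'.
have xx : x = x'.
  apply: (branch_trivIset rx rx'); exists (branch_member x p); split;
    first exact: branch_member_in.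
  by rewrite pp; exact: branch_member_in.
by subst x'; split => //; exact: branch_member_inj pp.
Qed.

End Fibre.

(** * Convolution with a polynomial *)

Definition convolution (Q : {poly int}) (F : nat -> int) (n : nat) : int :=
  \sum_(i < n.+1) Q`_i * F (n - i)%N.

(** Coefficient n of a product of series involves [F] only up to n; after truncation it is a product
    of polynomials, and the ring laws carry over. *)
Lemma convolutionE Q F n N : (n <= N)%N ->
  convolution Q F n = (Q * \poly_(i < N.+1) F i)`_n.
Proof.
move=> nN; rewrite coefM; apply: eq_bigr => i _.
by rewrite coef_poly ifT //; lia.
Qed.

Lemma eq_convolution Q F G : F =1 G -> convolution Q F =1 convolution Q G.
Proof. by move=> FG n; apply: eq_bigr => i _; rewrite FG. Qed.

Lemma convolution_mul A B F n :
  convolution (A * B) F n = convolution A (convolution B F) n.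
Proof.
rewrite (@convolutionE _ _ n n) // -mulrA coefM; apply: eq_bigr => i _.
by rewrite (@convolutionE B F _ n) // leq_subr.
Qed.

Lemma convolution_mulC A B F n :
  convolution A (convolution B F) n = convolution B (convolution A F) n.
Proof. by rewrite -!convolution_mul mulrC. Qed.

Lemma convolution_sum (I : finType) (P : pred I) Q (F : I -> nat -> int) n :
  convolution Q (fun m => \sum_(x | P x) F x m) n =
    \sum_(x | P x) convolution Q (F x) n.
Proof. by rewrite exchange_big; apply: eq_bigr => i _; rewrite mulr_sumr. Qed.

Lemma convolutionXn w F n :
  convolution 'X^w F n = if (w <= n)%N then F (n - w)%N else 0.
Proof.
rewrite (@convolutionE _ _ n n) // coefXnM coef_poly ltnS leq_subr.
by case: (ltnP n w).
Qed.

Lemma convolution_1 F n : convolution 1 F n = F n.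
Proof. by rewrite -(expr0 'X) convolutionXn subn0. Qed.

Lemma convolution_1subXn w F n :
  convolution (1 - 'X^w) F n = F n - if (w <= n)%N then F (n - w)%N else 0.
Proof.
rewrite -convolutionXn !(@convolutionE _ _ n n) // mulrBl mul1r coefB.
by rewrite coef_poly ltnSn.
Qed.

Definition delta0 (n : nat) : int := (n == 0)%N%:R.

(** Each factor 1 - q^w removes one unknown, by the recursion [size_solutions_cons]. *)
Lemma convolution_solutions ws n : all (leq 1) ws ->
  convolution (\prod_(w <- ws) (1 - 'X^w))
    (fun m => (size (solutions ws m))%:Z) n
  = delta0 n.
Proof.
elim: ws n => [|w ws IH] n.
  by move=> _; rewrite big_nil convolution_1 /=; case: n.
rewrite big_cons mulrC => /= /andP[w0 ws0]; rewrite convolution_mul -IH //.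
apply: eq_convolution => m; rewrite convolution_1subXn size_solutions_cons //.
by rewrite PoszD; case: ifP => _ /=; ring.
Qed.

Lemma convolution_shift Q F e n :
    (forall m, convolution Q F m = delta0 m) ->
  convolution Q (convolution 'X^e F) n = 'X^e`_n.
Proof.
move=> QF; rewrite convolution_mulC (eq_convolution _ QF) convolutionXn coefXn.
rewrite /delta0; case: leqP => en; last by rewrite ltn_eqF.
by congr (nat_of_bool _)%:R; lia.
Qed.

Lemma ncard_uniq (T : choiceType) (A : set T) (s : seq T) :
  uniq s -> (forall x, A x <-> x \in s) -> ncard A = size s.
Proof.
move=> us As; have -> : A = [set` [fset x in s]%fset]%classic.
  by apply/seteqP; split=> x /=; rewrite inE => /As.
by rewrite /ncard set_fsetK card_fseq undup_id.
Qed.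

(** * Quasi-polynomials *)

(** The falling factorial x (x - 1) ... (x - n + 1), the monomial of difference calculus. *)
Definition falling (n : nat) : {poly rat} := \prod_(i < n) ('X - i%:R%:P).

(** Both terms contain x (x - 1) ... (x - n + 1); the remaining factors x + 1 and x - n differ by n
    + 1. *)
Lemma falling_diff n (x : rat) :
  (falling n.+1).[x + 1] - (falling n.+1).[x] = n.+1%:R * (falling n).[x].
Proof.
rewrite /falling !horner_prod big_ord_recl big_ord_recr /= !hornerE.
have -> : \prod_(i < n) ('X - (bump 0 i)%:R%:P).[x + 1] =
          \prod_(i < n) ('X - i%:R%:P).[x] :> rat.
  by apply: eq_bigr => i _; rewrite !hornerE /bump /= natrD; ring.
by rewrite -natr1; ring.
Qed.

Lemma size_falling n : size (falling n) = n.+1.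
Proof.
by rewrite /falling -(big_map (fun i : 'I_n => i%:R) xpredT
    (fun a : rat => 'X - a%:P)) size_prod_XsubC size_map -sum1_size
  sum_nat_const cardT size_enum_ord muln1.
Qed.

Lemma falling_coef n : (falling n)`_n = 1.
Proof.
have /monicP : falling n \is monic.
  by apply: monic_prod => i _; exact: monicXsubC.
by rewrite /lead_coef size_falling.
Qed.

(** Subtracting the top coefficient times a falling factorial lowers the degree, and the subtracted
    term integrates to a multiple of the next falling factorial. *)
Lemma discrete_antiderivative d (P : {poly rat}) : (size P <= d)%N ->
  exists S : {poly rat}, [/\ (size S <= d.+1)%N, S`_d = P`_d.-1 / d%:R &
    forall x, S.[x + 1] - S.[x] = P.[x]].
Proof.
elim: d P => [|d IH] P szP.
  exists 0; split=> [||x]; rewrite ?size_poly0 // ?coef0 ?invr0 ?mulr0 //.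
  by move: szP; rewrite leqn0 size_poly_eq0 => /eqP ->; rewrite !hornerE.
pose c := P`_d.
have [|S [szS _ dS]] := IH (P - c *: falling d).
  apply/leq_sizeP => j; rewrite leq_eqVlt coefB coefZ => /orP[/eqP <-|dj].
    by rewrite falling_coef mulr1 subrr.
  by rewrite !nth_default ?mulr0 ?subrr ?size_falling // (leq_trans szP).
have d0 : d.+1%:R != 0 :> rat by rewrite pnatr_eq0.
exists (S + (c / d.+1%:R) *: falling d.+1); split=> [||x].
- rewrite (leq_trans (size_polyD _ _)) // geq_max (leq_trans szS) //=.
  by rewrite (leq_trans (size_scale_leq _ _)) // size_falling.
- by rewrite coefD coefZ falling_coef mulr1 nth_default ?add0r.
have dSx : S.[x + 1] - S.[x] = P.[x] - c * (falling d).[x].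
  by rewrite dS hornerD hornerN hornerZ.
have -> : P.[x] = S.[x + 1] - S.[x] + c / d.+1%:R * (d.+1%:R * (falling d).[x]).
  by rewrite dSx mulrA divfK // subrK.
by rewrite -falling_diff !(hornerD, hornerZ); ring.
Qed.

(** A positive leading coefficient rules out cancellation in sums, so the degree stays exact. *)
Definition eventually_poly (d : nat) (h : nat -> rat) : Prop :=
  exists P : {poly rat}, [/\ (size P <= d.+1)%N, 0 < P`_d &
    exists k0, forall k, (k0 <= k)%N -> h k = P.[k%:R]].

Lemma eventually_poly_sum d m (h : nat -> nat -> rat) :
    (forall j, eventually_poly d (h j)) ->
  eventually_poly d (fun k => \sum_(j < m.+1) h j k).
Proof.
move=> hp; elim: m => [|m [P [szP P0 [k0 Pk]]]].
  have [P [szP P0 [k0 Pk]]] := hp 0%N.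
  by exists P; split => //; exists k0 => k kk; rewrite big_ord1 Pk.
have [Q [szQ Q0 [k1 Qk]]] := hp m.+1.
exists (P + Q); split;
  first by rewrite (leq_trans (size_polyD _ _)) // geq_max szP.
  by rewrite coefD addr_gt0.
exists (maxn k0 k1) => k; rewrite geq_max => /andP[/Pk kk /Qk kk1].
by rewrite big_ord_recr /= kk kk1 hornerD.
Qed.

(** From some point on, [h] minus an antiderivative of [P] has difference zero and is therefore
    constant. *)
Lemma eventually_poly_integrate d (h g : nat -> rat) :
    (exists k0, forall k, (k0 <= k)%N -> h k.+1 - h k = g k) ->
  eventually_poly d g -> eventually_poly d.+1 h.
Proof.
move=> [k0 hg] [P [szP P0 [k1 Pk]]].
have [S [szS Sd dS]] := discrete_antiderivative szP.
pose K := maxn k0 k1.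
exists (S + (h K - S.[K%:R])%:P); split.
- rewrite (leq_trans (size_polyD _ _)) // geq_max szS.
  exact: leq_trans (size_polyC_leq1 _) _.
- by rewrite coefD coefC addr0 Sd divr_gt0 // ltr0n.
exists K => k /subnK <-; elim: (k - K)%N => [|i IH].
  by rewrite add0n hornerD hornerC addrC subrK.
have -> : h (i.+1 + K)%N = h (i + K)%N + g (i + K)%N.
  by rewrite -hg ?addSn; [ring|rewrite /K; lia].
rewrite IH Pk; last by rewrite /K; lia.
by rewrite -dS !hornerD !hornerC addSn -natr1; ring.
Qed.

(* [r] ranges over all naturals, not only r < p, so that shifting the argument
   needs no reduction modulo p. *)
Definition eventually_poly_mod (p d : nat) (f : nat -> int) : Prop :=
  forall r, eventually_poly d (fun k => (f (r + p * k)%N)%:~R).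

(** A step of length [p] consists of p / w steps of length [w], so f (n + p) - f n is a sum of p / w
    values of [g], each eventually polynomial along its progression. *)
Lemma eventually_poly_mod_integrate p d w (f g : nat -> int) :
    (0 < p)%N -> (w %| p)%N ->
    (forall n, convolution (1 - 'X^w) f n = g n) ->
  eventually_poly_mod p d g -> eventually_poly_mod p d.+1 f.
Proof.
move=> p0 /dvdnP[[|m] ep] fg gp r; first by lia.
have w0 : (0 < w)%N by lia.
have step n : f (n + w)%N = f n + g (n + w)%N.
  by rewrite -fg convolution_1subXn leq_addl addnK; ring.
have steps n j : f (n + j * w)%N = f n + \sum_(i < j) g (n + i.+1 * w)%N.
  elim: j => [|j IH]; first by rewrite big_ord0 addr0 addn0.
  rewrite big_ord_recr /= addrA -IH -[in g _]addn1 mulnDl mul1n addnA -step.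
  by congr f; lia.
apply: (eventually_poly_integrate
  (g := fun k => \sum_(i < m.+1) (g (r + i.+1 * w + p * k)%N)%:~R)).
  exists 0%N => k _; rewrite mulnSr addnA {2}ep steps rmorphD /= addrC addKr.
  by rewrite rmorph_sum /=; apply: eq_bigr => i _; congr (g _)%:~R; lia.
exact: (@eventually_poly_sum d m (fun i k => (g (r + i.+1 * w + p * k)%N)%:~R)).
Qed.

(** For large n congruent to r modulo [p] the value is P_r((n - r) / p); expanded in n, its
    coefficients depend only on n mod p. *)
Lemma eventually_poly_mod_quasi p d (f : nat -> nat) : (0 < p)%N ->
  eventually_poly_mod p d (fun n => (f n)%:Z) ->
  eventually_quasi_polynomial d f.
Proof.
move=> p0 /choice[P fP].
have /choice[k0 fk0] : forall r, exists k0, forall k, (k0 <= k)%N ->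
   (f (r + p * k)%N)%:R = (P r).[k%:R] by move=> r; have [_ _] := fP r.
have pne : p%:R != 0 :> rat by rewrite pnatr_eq0 -lt0n.
pose q r : {poly rat} := p%:R^-1 *: ('X - r%:R%:P).
have szq r : size (q r) = 2%N by rewrite size_scale ?invr_eq0 // size_XsubC.
have size_comp r : (size (P r \Po q r) <= d.+1)%N.
  have [szP _ _] := fP r.
  rewrite (leq_trans (size_comp_poly_leq _ _)) // szq muln1 ltnS.
  by move: szP; case: size.
pose a i n := (P (n %% p)%N \Po q (n %% p)%N)`_i.
exists (fun n => (P (n %% p)%N).[(n %/ p)%N%:R]); split.
  exists p, a; split=> //.
  - by move=> i n; rewrite /a modnDr.
  (* At residue 0 the top coefficient is that of [P 0] divided by p^d. *)
  - exists 0%N; rewrite /a mod0n; apply/eqP.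
    have [szP Pd _] := fP 0%N.
    have eP : size (P 0%N) = d.+1.
      by apply/eqP; rewrite eqn_leq szP /= ltnNge;
        apply: contraTN Pd => /leq_sizeP ->; rewrite ?ltxx.
    have := lead_coef_comp (P 0%N) (_ : (1 < size (q 0%N))%N);
      rewrite szq => /(_ isT).
    rewrite /lead_coef size_comp_poly szq muln1 !eP /= => ->.
    apply: mulf_neq0; first by rewrite gt_eqF.
    by rewrite expf_neq0 // coefZ coefB coefX coefC subr0 mulr1 invr_eq0.
  move=> n; rewrite -(horner_coef_wide _ (size_comp _)) horner_comp.
  congr (P _).[_]; rewrite /q !hornerE {2}(divn_eq n p) natrD natrM.
  by rewrite addrK mulrC mulfK.
(* Past this bound [n %/ p] has reached the threshold of every residue. *)
exists (p * \max_(r < p) k0 r)%N => n nk.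
rewrite {1}(divn_eq n p) addnC mulnC fk0 //.
rewrite leq_divRL // mulnC (leq_trans _ nk) // leq_mul2l.
by rewrite (leq_bigmax (Ordinal (ltn_pmod n p0))) orbT.
Qed.

(** * The counting functions of the fibre *)

Section Counting.
Variables (t k l d3 : nat).
Hypothesis t_gt1 : (1 < t)%N.

Let t_gt0 : (0 < t)%N := ltnW t_gt1.
Let d1 := (t * k.+1)%N.
Let d2 := (t * l.+1)%N.
(* Raising v by one moves both two-element classes, hence the weight 4t. *)
Let ws := (4 * t)%N :: nseq (t - 2) t.

Let size_ws : size ws = t.-1. Proof. by rewrite /= size_nseq; lia. Qed.

Let ws_gt0 : all (leq 1) ws.
Proof. by rewrite /= all_nseq t_gt0 orbT andbT; lia. Qed.

Lemma weight_ws p : size p = t.-1 ->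
  weight ws p = (4 * t * head 0 p + t * sumn (behead p))%N.
Proof.
case: p => [|a p] /= szp; first by lia.
have {}szp : size p = (t - 2)%N by lia.
rewrite mulnC; congr (_ + _)%N; rewrite -szp.
by elim: p {szp} => [|b p IH] /=; [rewrite muln0 | rewrite IH; lia].
Qed.

Lemma count_eqE n : (count_eq t d1 d2 d3 n)%:Z =
  \sum_(x : branch_index t | representative d1 d2 d3 x)
    convolution 'X^(min_size k l d3 x) (fun m => (size (solutions ws m))%:Z) n.
Proof.
(* The parameters of the members of size [n]: they have to account for the excess of [n] over the
   least size on the branch. *)
pose sols (x : branch_index t) :=
  if (min_size k l d3 x <= n)%N then solutions ws (n - min_size k l d3 x)
  else [::].
pose reps := [seq x <- enum {: branch_index t} | representative d1 d2 d3 x].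
have sols_size x p : p \in sols x -> size p = t.-1.
  by rewrite /sols; case: ifP => // _;
    rewrite mem_solutions // size_ws => /andP[/eqP].
rewrite /count_eq (@ncard_uniq _ _
  [seq branch_member k l d3 x p | x <- reps, p <- sols x]).
- rewrite size_allpairs_dep sumnE big_map big_filter big_enum_cond /=
  -[LHS]natz.
  rewrite natr_sum; apply: eq_bigr => x _; rewrite convolutionXn /sols natz.
  by case: ifP.
- apply: allpairs_uniq_dep => [|x _|[x p] [x' p']].
  + by rewrite filter_uniq // enum_uniq.
  + by rewrite /sols; case: ifP => // _; exact: solutions_uniq.
  move=> /allpairsPdep[y [q [yr qs [ex ep]]]].
  move=> /allpairsPdep[y' [q' [yr' qs' [ex' ep']]]].
  subst; move: yr yr'; rewrite !mem_filter => /andP[ry _] /andP[ry' _] /= pp.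
  by have [-> ->] := branch_member_representative_inj t_gt1 ry ry'
    (sols_size _ _ qs) (sols_size _ _ qs') pp.
move=> la; split.
  move=> [/(fibre_members k l d3 t_gt1)[x [p [rx szp ->]]]] /= sz;
    have /andP[ax _] := rx.
  apply/allpairsPdep; exists x, p; split=> //;
    first by rewrite mem_filter rx mem_enum.
  move: sz; rewrite sumn_branch_member // -weight_ws // /sols => <-.
  by rewrite leq_addr mem_solutions // szp size_ws addKn !eqxx.
move=> /allpairsPdep[x [p [+ ps ->]]]; rewrite mem_filter => /andP[rx _].
have szp := sols_size _ _ ps; have /andP[ax _] := rx.
split; first by apply/(fibre_members k l d3 t_gt1); exists x, p.
rewrite /= sumn_branch_member // -weight_ws //; move: ps; rewrite /sols;
  case: ifP => // le.
by rewrite mem_solutions // => /andP[_ /eqP ->]; rewrite subnKC.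
Qed.

Lemma branch_denominatorE :
  branch_denominator t = \prod_(w <- ws) (1 - 'X^w).
Proof. by rewrite big_cons big_nseq iter_mulr_1. Qed.

Lemma convolution_count_eq n :
  convolution (branch_denominator t) (fun m => (count_eq t d1 d2 d3 m)%:Z) n
  = (branch_numerator t d1 d2 d3)`_n.
Proof.
rewrite (eq_convolution _ count_eqE) convolution_sum /branch_numerator coef_sum.
apply: eq_bigr => x /andP[ax _].
rewrite convolution_shift => [|m]; first by rewrite expoE // natrK.
by rewrite branch_denominatorE convolution_solutions.
Qed.

Lemma count_series :
  series_quotient (fun n => (count_eq t d1 d2 d3 n)%:Z)
    (branch_numerator t d1 d2 d3) (branch_denominator t).
Proof.
split; last exact: convolution_count_eq.
have X0 w : (0 < w)%N -> (1 - 'X^w : {poly int}).[0] = 1.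
  by move=> w0; rewrite hornerD hornerN hornerXn hornerC expr0n gtn_eqF //
    subr0.
rewrite -horner_coef0 hornerM horner_exp !X0 ?expr1n ?mulr1 //.
by rewrite muln_gt0.
Qed.

(** Sizes at most n + 1 split into n + 1 and at most n; finiteness of both sets lets the cardinals
    add. *)
Lemma count_le_diff n :
  convolution (1 - 'X) (fun m => (count_le t d1 d2 d3 m)%:Z) n
  = (count_eq t d1 d2 d3 n)%:Z.
Proof.
rewrite -['X]expr1 convolution_1subXn.
have fin m := finite_sumn_le t.+2 m.
pose C m := fibre t d1 d2 d3 `&` [set la | sumn la = m].
pose L m := fibre t d1 d2 d3 `&` [set la | (sumn la <= m)%N].
have finL m : finite_set (L m) by apply: sub_finite_set (fin m);
  exact: subIsetr.
have finC m : finite_set (C m).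
  by apply: sub_finite_set (finL m) => la [? /= <-]; split=> /=.
case: n => [|n].
  rewrite subr0 /count_le /count_eq; congr (Posz (ncard (_ `&` _))).
  by apply/funext => la; rewrite /mkset leqn0; apply/propext; split=> /eqP.
rewrite subSS subn0 /=; apply/eqP; rewrite subr_eq -PoszD eqz_nat; apply/eqP.
rewrite {1}/count_le (@ncard_uniq _ _ (fset_set (C n.+1) ++ fset_set (L n))).
- by rewrite size_cat.
- rewrite cat_uniq !fset_uniq andbT /=; apply/hasPn => la.
  rewrite !in_fset_set // => /set_mem[_ /= lan]; apply/negP => /set_mem[_ /= E].
  by rewrite E ltnn in lan.
move=> la; rewrite mem_cat !in_fset_set //; split=> [[fla /= lan]|].
  have [le|gt] := leqP (sumn la) n; apply/orP; [right|left];
    apply/mem_set => //.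
  by split=> //=; apply/eqP; rewrite eqn_leq lan.
move=> /orP[] /set_mem[fla /= lan]; split=> //=; first by rewrite lan.
exact: leqW.
Qed.

(** Moving [v] alone, with every m_i zero, injects the naturals into the fibre. *)
Lemma fibre_infinite (x : branch_index t) :
  representative d1 d2 d3 x -> infinite_set (fibre t d1 d2 d3).
Proof.
move=> rx fin; apply: infinite_nat.
pose p w := w :: nseq (t - 2) 0%N.
have szp w : size (p w) = t.-1 by rewrite /= size_nseq; lia.
have := finite_preimage (f := fun w => branch_member k l d3 x (p w)) _ fin.
have -> : (fun w => branch_member k l d3 x (p w)) @^-1` fibre t d1 d2 d3 =
  [set: nat].
  by apply/seteqP; split=> // w _; apply/(fibre_members k l d3 t_gt1);
    exists x, (p w).
apply=> w w' _ _ ww; have /andP[ax _] := rx.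
by have [] := branch_member_inj t_gt1 ax (szp w) (szp w') ww.
Qed.

Lemma count_le_quasi (x : branch_index t) : representative d1 d2 d3 x ->
  eventually_quasi_polynomial t.-1 (count_le t d1 d2 d3).
Proof.
move=> rx; set P := branch_numerator t d1 d2 d3.
pose L n : int := (count_le t d1 d2 d3 n)%:Z.
pose p := (4 * t)%N.
have base : eventually_poly_mod p 0 (convolution (branch_denominator t) L).
  set g := convolution _ L.
  (* The factor 1 - q turns counts up to n into counts at n, whose product with the denominator is
     the numerator. *)
  have gS n : g n.+1 = g n + P`_n.+1.
    rewrite -convolution_count_eq -(eq_convolution _ count_le_diff).
    rewrite convolution_mulC -['X]expr1 convolution_1subXn subSS subn0 /=.
    by rewrite -/L -/g; ring.
  have g0 : g 0%N = P`_0.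
    rewrite -convolution_count_eq -(eq_convolution _ count_le_diff).
    by rewrite convolution_mulC -['X]expr1 convolution_1subXn subr0.
  have gE n : g n = \sum_(i < n.+1) P`_i.
    by elim: n => [|n IH]; rewrite ?big_ord1 // big_ord_recr /= -IH gS.
  (* At 1 the numerator takes the number of branches as its value, and [x] is one of them. *)
  have P1 : 0 < P.[1].
    rewrite horner_sum (bigD1 x) //= hornerXn expr1n ltr_pwDl //.
    by apply: sumr_ge0 => y _; rewrite hornerXn expr1n.
  move=> r; exists (P.[1]%:~R)%:P; split; first exact: size_polyC_leq1.
    by rewrite coefC /= ltr0z.
  exists (size P) => n Pn; rewrite hornerC gE; congr _%:~R.
  have szP : (size P <= (r + p * n).+1)%N by rewrite /p; nia.
  by rewrite (horner_coef_wide _ szP); apply: eq_bigr => i _;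
    rewrite expr1n mulr1.
apply: (@eventually_poly_mod_quasi p) => //; first by rewrite /p; lia.
rewrite -/L; have : all (fun w => w %| p)%N ws.
  by rewrite /= dvdnn /= all_nseq /p dvdn_mull ?orbT.
rewrite -size_ws; rewrite branch_denominatorE in base.
have -> : size ws = (0 + size ws)%N by [].
(* The factors are removed one at a time; the claim is generalised over the degree [d] reached so
   far and the function [F], and each removal raises the degree by one. *)
elim: (ws) 0%N L base => [|w s IH] d F base.
  move=> _; rewrite addn0 => r; have [Q [szQ Qd [k0 Qk]]] := base r.
  exists Q; split=> //; exists k0 => n nk; rewrite -Qk //; congr _%:~R.
  by rewrite big_nil convolution_1.
move=> /= /andP[wp sp]; rewrite addnS -addSn; apply: IH => //.
move: base; rewrite big_cons; apply: eventually_poly_mod_integrate wp _;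
  first by rewrite /p; lia.
by move=> n; rewrite convolution_mul.
Qed.

End Counting.

Theorem corollary3p7 (t d1 d2 d3 : nat) (ht : (2 <= t)%N)
    (hd : exists la : t.+2.-tuple nat,
        two_class t la /\ interval_triple t la = (d1, d2, d3)) :
  infinite_set (fibre t d1 d2 d3)
  /\ fibre t d1 d2 d3 =
       \bigcup_(x in [set x | admissible d1 d2 d3 x]) branch d1 d2 d3 x
  /\ (d3 = 0%N -> forall rA rB : 'I_t,
       admissible d1 d2 d3 (rA, rB, false) =
         admissible d1 d2 d3 (rA, rB, true)
       /\ branch d1 d2 d3 (rA, rB, false) = branch d1 d2 d3 (rA, rB, true))
  /\ trivIset [set x | representative d1 d2 d3 x] (@branch t d1 d2 d3)
  /\ (forall x : branch_index t, admissible d1 d2 d3 x ->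
       forall (v : int) (m : nat -> nat),
         Num.max 0 (branch_shift d1 d2 d3 x) <= v%:~R ->
         exists! la : t.+2.-tuple nat, branch_point d1 d2 d3 x v m la)
  /\ (forall x : branch_index t, admissible d1 d2 d3 x ->
       expo d1 d2 d3 x \is a Num.nat)
  /\ series_quotient (fun n => (count_eq t d1 d2 d3 n)%:Z)
       (branch_numerator t d1 d2 d3) (branch_denominator t)
  /\ eventually_quasi_polynomial t.-1 (count_le t d1 d2 d3).
Proof.
have t_gt0 : (0 < t)%N := ltnW ht.
have [k [l [Ed1 Ed2]]] : exists k l, d1 = (t * k.+1)%N /\ d2 = (t * l.+1)%N.
  have [la [cla]] := hd.
  have [rA [rB [v [k [u [l [m [rAB rBt sla qla]]]]]]]] :=
    two_class_quotientP t_gt0 cla.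
  by rewrite (interval_triple_two_class rAB rBt sla qla) => -[<- <- _];
    exists k, l.
(* The given point lies on some branch; both the infinitude and the exact degree rest on there being
   one. *)
have [x rx] : exists x : branch_index t, representative d1 d2 d3 x.
  have [la fla] := hd; move: fla; rewrite Ed1 Ed2.
  by move=> /(fibre_members k l d3 ht)[x [p [rx _ _]]]; exists x.
subst d1 d2; split; first exact: fibre_infinite rx.
split; first exact: fibre_branches.
split; first by move=> d30 rA rB; exact: branch_sign0.
split; first exact: branch_trivIset.
split; first by move=> y ay v m vy; exact: branch_point_unique.
split; first by move=> y ay; rewrite expoE // natr_nat.
split; first exact: count_series.
exact: count_le_quasi rx.
Qed.
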